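(* Let $G=(V,E)$ be a finite, simple, undirected, connected, unweighted graph with $n$ nodes and diameter $\Delta_G$, let $v\in V$, $\epsilon>0$, $p_f\in(0,1)$, and let $\omega\ge \frac{32\Delta_G^2\log(2n/p_f)}{\epsilon^2}$. Let $T_1,\dots,T_\omega$ be independent uniformly random spanning trees of $G$ and for each $u\in V$ define $$(\widetilde{L^\dagger})_{uu}=\frac1\omega\sum_{i=1}^\omega\Big(x^{(1)}_{T_i}(u)-2x^{(2)}_{T_i}(u)+\frac1n\sum_{w\in V}x^{(2)}_{T_i}(w)\Big).$$ Then with probability at least $1-p_f$, $|(\widetilde{L^\dagger})_{uu}-(L^\dagger)_{uu}|\le\epsilon$ for all $u\in V$.
   Context: $L=D-A$ is the Laplacian and $L^\dagger$ its Moore–Penrose pseudo-inverse; $\log$ is the natural logarithm. Fix a breadth-first-search tree of $G$ rooted at $v$, and for $u\in V$ let $B(u)$ be its path from $u$ to $v$, as a sequence of directed edges $(a,b)$ oriented towards $v$ (empty if $u=v$). For a spanning tree $T$ rooted at $v$ and $a\ne v$, let $\mathrm{par}_T(a)$ be the neighbor of $a$ on the $T$-path from $a$ to $v$, and $\mathrm{sub}_T(a)$ the set of nodes whose $T$-path to $v$ passes through $a$ (including $a$). For a directed edge $(a,b)$ set $\sigma^u_T(a,b)=1$ if $b=\mathrm{par}_T(a)$ and $u\in\mathrm{sub}_T(a)$; $\sigma^u_T(a,b)=-1$ if $a=\mathrm{par}_T(b)$ and $u\in\mathrm{sub}_T(b)$; $0$ otherwise. Set $f_T(a,b)=|\mathrm{sub}_T(a)|/n$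 if $b=\mathrm{par}_T(a)$, $f_T(a,b)=-|\mathrm{sub}_T(b)|/n$ if $a=\mathrm{par}_T(b)$, and $0$ otherwise. Define $x^{(1)}_T(u)=\sum_{(a,b)\in B(u)}\sigma^u_T(a,b)$ and $x^{(2)}_T(u)=\sum_{(a,b)\in B(u)}f_T(a,b)$. *)

(* Defs.v *)
From HB Require Import structures.
From mathcomp Require Import all_boot all_order all_algebra.
From mathcomp Require Import all_classical all_reals all_analysis.

Set Implicit Arguments.
Unset Strict Implicit.
Unset Printing Implicit Defensive.
Import Order.TTheory GRing.Theory Num.Theory.
Local Open Scope ring_scope.

Section Graph.
Variables (V : finType) (e : rel V).

Definition connected_graph : Prop := forall x y : V, connect e x y.

Definition walk_of_length (x y : V) (k : nat) : bool :=
  [exists p : k.-tuple V, path e x p && (last x p == y)].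

(* The least length of a walk from x to y; a shortest walk has fewer than #|V|
   edges, and the value is #|V| by convention if y is not reachable from x. *)
Definition gdist (x y : V) : nat := find (walk_of_length x y) (iota 0 #|V|).

Definition diameter : nat := (\max_(x : V) \max_(y : V) gdist x y)%N.

Definition edges : {set {set V}} :=
  ([set [set p.1; p.2] | p in [pred p : V * V | e p.1 p.2]])%SET.

Definition adj_of (F : {set {set V}}) : rel V :=
  fun x y => ([set x; y]%SET \in F).

Definition acyclic (r : rel V) : Prop :=
  forall c : seq V, (2 < size c)%N -> ~ ucycle r c.

Definition is_spanning_tree (F : {set {set V}}) : Prop :=
  [/\ F \subset edges,
      forall x y : V, connect (adj_of F) x y
    & acyclic (adj_of F)].

Definition spanning_trees : {set {set {set V}}} :=
  ([set F | `[< is_spanning_tree F >]])%SET.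

End Graph.

Section RootedTree.
Variables (R : realType) (V : finType) (v : V).

(* x :: p is a simple path of the graph (V, F) from x to the root v *)
Definition is_root_path (F : {set {set V}}) (x : V) (p : seq V) : Prop :=
  [/\ path (adj_of F) x p, last x p = v & uniq (x :: p)].

(* The vertices after x on the path of the tree F from x to the root v; the
   path exists and is unique whenever F is a spanning tree. *)
Definition root_path (F : {set {set V}}) (x : V) : seq V :=
  xget [::] [set p | is_root_path F x p]%classic.

(* A spanning tree is a breadth-first-search tree rooted at v when its path
   between v and each vertex is a shortest path of the graph. *)
Definition is_bfs_tree (e : rel V) (F : {set {set V}}) : Prop :=
  is_spanning_tree e F /\ forall u : V, size (root_path F u) = gdist e u v.

Definition root_path_edges (F : {set {set V}}) (u : V) : seq (V * V) :=
  zip (u :: root_path F u) (root_path F u).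

(* None exactly at the root *)
Definition par (F : {set {set V}}) (a : V) : option V :=
  ohead (root_path F a).

Definition subtree (F : {set {set V}}) (a : V) : {set V} :=
  ([set u | a \in u :: root_path F u])%SET.

Definition sigma (F : {set {set V}}) (u : V) (ab : V * V) : R :=
  if (par F ab.1 == Some ab.2) && (u \in subtree F ab.1) then 1
  else if (par F ab.2 == Some ab.1) && (u \in subtree F ab.2) then -1
  else 0.

Definition flow (F : {set {set V}}) (ab : V * V) : R :=
  if par F ab.1 == Some ab.2 then #|subtree F ab.1|%:R / #|V|%:R
  else if par F ab.2 == Some ab.1 then - (#|subtree F ab.2|%:R / #|V|%:R)
  else 0.

(* B is the BFS tree, F the sampled spanning tree *)
Definition x1 (B F : {set {set V}}) (u : V) : R :=
  \sum_(ab <- root_path_edges B u) sigma F u ab.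

Definition x2 (B F : {set {set V}}) (u : V) : R :=
  \sum_(ab <- root_path_edges B u) flow F ab.

Definition estimator (B : {set {set V}}) (omega : nat)
    (T : 'I_omega -> {set {set V}}) (u : V) : R :=
  omega%:R^-1 * \sum_(i < omega)
    (x1 B (T i) u - 2 * x2 B (T i) u
     + #|V|%:R^-1 * \sum_(w : V) x2 B (T i) w).

End RootedTree.

Section Laplacian.
Variables (R : realType) (V : finType) (e : rel V).

(* Matrices indexed by V are indexed through the enumeration of V. *)
Definition adjacency_mx : 'M[R]_#|V| :=
  \matrix_(i, j) (e (enum_val i) (enum_val j))%:R.

Definition degree_mx : 'M[R]_#|V| :=
  diag_mx (\row_i #|[set w | e (enum_val i) w]%SET|%:R).

Definition laplacian : 'M[R]_#|V| := degree_mx - adjacency_mx.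

End Laplacian.

Section MoorePenrose.
Variables (R : realType) (m n : nat).

(* the four Penrose conditions (over the reals, adjoint = transpose) *)
Definition is_moore_penrose (A : 'M[R]_(m, n)) (X : 'M[R]_(n, m)) : Prop :=
  [/\ A *m X *m A = A, X *m A *m X = X,
      (A *m X)^T = A *m X & (X *m A)^T = X *m A].

Definition moore_penrose (A : 'M[R]_(m, n)) : 'M[R]_(n, m) :=
  xget 0 [set X | is_moore_penrose A X]%classic.

Lemma is_moore_penrose_unique (A : 'M[R]_(m, n)) (X Y : 'M[R]_(n, m)) :
  is_moore_penrose A X -> is_moore_penrose A Y -> X = Y.
Proof.
move=> [AX XA sX tX] [AY YA sY tY].
have E1 : A *m X = A *m Y.
  by rewrite -sX -{1}AY -(mulmxA (A *m Y)) trmx_mul sX sY mulmxA AX.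
have E2 : X *m A = Y *m A.
  by rewrite -tX -{1}AY -(mulmxA A Y A) mulmxA trmx_mul tX tY -(mulmxA Y)
       (mulmxA A) AX.
by rewrite -XA E2 -mulmxA E1 mulmxA YA.
Qed.

End MoorePenrose.

Lemma trmx_mul_eq0 (R : realType) (m : nat) (v : 'rV[R]_m) :
  v *m v^T = 0 -> v = 0.
Proof.
move=> /matrixP /(_ 0 0); rewrite !mxE => /eqP h.
apply/rowP => j; rewrite mxE; apply/eqP.
move: h; rewrite psumr_eq0; last by move=> i _; rewrite mxE -expr2 sqr_ge0.
by move=> /allP /(_ j (mem_index_enum _)); rewrite /= mxE mulf_eq0 orbb.
Qed.

Lemma gram_unitmx (R : realType) (r n : nat) (B : 'M[R]_(r, n)) :
  row_free B -> B *m B^T \in unitmx.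
Proof.
move=> fB; rewrite -row_free_unit -kermx_eq0; apply/eqP/row_matrixP => i.
rewrite row0; have : row i (kermx (B *m B^T)) *m (B *m B^T) = 0.
  by rewrite -row_mul mulmx_ker row0.
set u := row i _ => h.
have : (u *m B) *m (u *m B)^T = 0 by rewrite trmx_mul !mulmxA -(mulmxA u) h mul0mx.
move/trmx_mul_eq0 => uB0; apply/eqP.
by rewrite -(mulmx_free_eq0 u fB) uB0.
Qed.

Lemma moore_penroseP (R : realType) (m n : nat) (A : 'M[R]_(m, n)) :
  is_moore_penrose A (moore_penrose A).
Proof.
apply: (@xgetPex _ 0 [set X | is_moore_penrose A X]%classic) => /=.
have [r [C [B [-> fC fB]]]] : exists r (C : 'M[R]_(m, r)) (B : 'M[R]_(r, n)),
    [/\ A = C *m B, row_free C^T & row_free B].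
  exists (\rank A), (col_base A), (row_base A).
  rewrite mulmx_base row_base_free; split=> //.
  by rewrite /row_free mxrank_tr; exact: col_base_full.
have uB := gram_unitmx fB; have uC := gram_unitmx fC; rewrite trmxK in uC.
set P := invmx (B *m B^T); set Q := invmx (C^T *m C).
have sP : P^T = P by rewrite trmx_inv trmx_mul trmxK.
have sQ : Q^T = Q by rewrite trmx_inv trmx_mul trmxK.
have BP : B *m (B^T *m P) = 1%:M by rewrite mulmxA mulmxV.
have QC : Q *m C^T *m C = 1%:M by rewrite -mulmxA mulVmx.
exists (B^T *m P *m (Q *m C^T)).
have AX : C *m B *m (B^T *m P *m (Q *m C^T)) = C *m (Q *m C^T).
  by rewrite mulmxA -(mulmxA C) BP mulmx1.
have XA : B^T *m P *m (Q *m C^T) *m (C *m B) = B^T *m P *m B.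
  by rewrite mulmxA -(mulmxA (B^T *m P)) QC mulmx1.
split.
- by rewrite AX -mulmxA (mulmxA (Q *m C^T)) QC mul1mx.
- by rewrite XA -!mulmxA (mulmxA B) (mulmxA (B *m _)) mulmxV // mul1mx.
- by rewrite AX !trmx_mul trmxK sQ mulmxA.
- by rewrite XA !trmx_mul trmxK sP mulmxA.
Qed.

Local Open Scope classical_set_scope.

Section RandomTrees.
Variables (R : realType) (d : measure_display) (Omega : measurableType d).
Variables (P : probability Omega R) (S : finType).

(* X is a random element of the finite set S (with the discrete
   sigma-algebra) with the uniform law on D *)
Definition uniformly_distributed (D : {set S}) (X : Omega -> S) : Prop :=
  (forall A : set S, measurable (X @^-1` A)) /\
  (forall s : S,
    P (X @^-1` [set s]) = (if s \in D then #|D|%:R^-1 else 0)%:E).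

Definition mutually_independent (k : nat) (X : 'I_k -> Omega -> S) : Prop :=
  forall (J : {set 'I_k}) (A : 'I_k -> set S),
    P (\bigcap_(i in [set i | i \in J]) (X i @^-1` A i)) =
    (\prod_(i in J) P (X i @^-1` A i))%E.

End RandomTrees.

(* Main.v *)
(** Fix [w].  Deleting the edge [ab] from a spanning tree whose path from [w] to
    the root [v] traverses [a -> b] leaves a two-component spanning forest that
    separates [w] from [v], with [a] on the side of [w] and [b] on the side of
    [v]; adding [ab] back inverts this.  Hence, summed over all spanning trees,
    [sigma^w (a, b)] equals [h a - h b], where [h x] counts the separating
    forests with [x] on the side of [w].  Since each tree path also satisfies
    Kirchhoff's node law, [h] divided by the number of trees solves
    [L phi = delta_w - delta_v] and [phi v = 0], and is thus expressed through
    the pseudo-inverse of [L]; telescoping along the BFS paths, the mean of one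
    sample is [(L^+)_uu].

    A sample is at most [3 Delta] in absolute value, because [sigma] and [f] have
    equal signs on each edge.  Computed with root [u], [(L^+)_uu] is an average
    of potentials that change by at most [1] along an edge, so it is at most
    [Delta].  A centred sample is therefore bounded by [4 Delta], and the
    elementary form of Hoeffding's bound (from [cosh t <= exp (t^2/2)]) with a
    union bound over [u] and the sign gives the constant [32]. *)

Require Import Defs.
From HB Require Import structures.
From mathcomp Require Import all_boot all_order all_algebra.
From mathcomp Require Import all_classical all_reals all_analysis.
From mathcomp Require Import ring lra.

Set Implicit Arguments.
Unset Strict Implicit.
Unset Printing Implicit Defensive.
Import Order.TTheory GRing.Theory Num.Theory.

Local Notation conn F := (connect (adj_of F)).

(** * Edge sets as graphs: deletion of an edge, forests, uniqueness of paths *)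

Section EdgeSets.
Variable V : finType.
Implicit Types (F : {set {set V}}) (a b x y : V) (p q : seq V).

Lemma eq_set2 x y a b : [set x; y]%SET = [set a; b]%SET ->
  (x = a /\ y = b) \/ (x = b /\ y = a).
Proof.
move=> E.
have := set21 x y; rewrite E => /set2P xab.
have := set22 x y; rewrite E => /set2P yab.
have := set21 a b; rewrite -E => /set2P axy.
have := set22 a b; rewrite -E => /set2P bxy.
by case: xab yab axy bxy => -> [->|->] [] ? [] ?; subst; auto.
Qed.

Lemma adj_of_sym F : symmetric (adj_of F).
Proof. by move=> x y; rewrite /adj_of finset.setUC. Qed.

Lemma conn_sym F : connect_sym (adj_of F).
Proof. exact: sym_connect_sym (adj_of_sym F). Qed.

Lemma conn_subset F F' x y : F \subset F' -> conn F x y -> conn F' x y.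
Proof.
move=> /fintype.subsetP sub; apply: connect_sub => c d cd; apply: connect1.
exact: sub.
Qed.

Definition del F a b : {set {set V}} := (F :\ [set a; b])%SET.

Lemma delC F a b : del F a b = del F b a.
Proof. by rewrite /del [[set a; b]%SET]finset.setUC. Qed.

Lemma del_subset F a b : del F a b \subset F.
Proof. exact: subD1set. Qed.

Lemma adj_del F a b x y :
  adj_of (del F a b) x y = ([set x; y]%SET != [set a; b]%SET) && adj_of F x y.
Proof. by rewrite /adj_of in_setD1. Qed.

Lemma path_del F a b x p : a \notin x :: p ->
  path (adj_of F) x p -> path (adj_of (del F a b)) x p.
Proof.
move=> axp; apply: (@sub_in_path _ (predC1 a)).
  move=> c d; rewrite !inE => ca da cd; rewrite adj_del cd andbT.
  by apply/eqP => /eq_set2[] [] ? ?; subst; rewrite eqxx in ca da.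
by apply/allP => c cxp; rewrite /=; apply: contraNneq axp => <-.
Qed.

Lemma path_conn F x p : path (adj_of F) x p -> conn F x (last x p).
Proof. by move=> xp; apply/connectP; exists p. Qed.

Lemma conn_simple F x y : conn F x y ->
  exists p, [/\ path (adj_of F) x p, last x p = y & uniq (x :: p)].
Proof.
by case/connectP=> p /shortenP[p' xp' Up' _] ->; exists p'.
Qed.

(** The targets [y] for which one of the three cases holds form a set that contains [x] and is
    closed under adjacency in [F]. *)
Lemma conn_delP F a b x y : conn F x y ->
  let F' := del F a b in
  [\/ conn F' x y, conn F' x a /\ conn F' b y | conn F' x b /\ conn F' a y].
Proof.
move=> xy F'; set G := conn F'.
pose S := [pred z | [|| G x z, G x a && G b z | G x b && G a z]].
suff clS : fingraph.closed (adj_of F) S.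
  have : x \in S by rewrite !inE /G connect0.
  rewrite (closed_connect clS xy) !inE => /or3P[?|/andP[]|/andP[]];
    by [constructor 1|constructor 2|constructor 3].
apply: intro_closed; first exact: conn_sym.
move=> c d cd; rewrite !inE.
have [/eqP/eq_set2[] [-> ->]|ne] := boolP ([set c; d]%SET == [set a; b]%SET).
- rewrite /G !connect0 !andbT.
  by case/or3P => [->|/andP[-> _]|->]; rewrite ?orbT.
- rewrite /G !connect0 !andbT.
  by case/or3P => [->|->|/andP[-> _]]; rewrite ?orbT.
have Gcd : conn F' c d by apply: connect1; rewrite adj_del ne.
case/or3P => [xc|/andP[xa bc]|/andP[xb ac]].
- by rewrite /G (connect_trans xc Gcd).
- by rewrite xa /G (connect_trans bc Gcd) orbT.
- by rewrite xb /G (connect_trans ac Gcd) !orbT.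
Qed.

(* Acyclicity, phrased as: every edge is a bridge. *)
Definition forest F := forall x y, x != y -> adj_of F x y ->
  ~~ conn (del F x y) x y.

Lemma forest_subset F F' : F' \subset F -> forest F -> forest F'.
Proof.
move=> sub fF x y xy axy; apply: contra (fF x y xy (fintype.subsetP sub _ axy)).
exact/conn_subset/finset.setSD.
Qed.

(** A simple path that bypasses an edge closes up with it to a cycle; conversely, a cycle minus one
    edge still joins the ends of that edge. *)
Lemma acyclic_forest F : acyclic (adj_of F) <-> forest F.
Proof.
split=> [acF x y xy axy|fF [|x [|y [|z s]]] //= _ /andP[]].
  (* A bypass of length zero contradicts [x != y], and one of length one would be the deleted edge,
     so the cycle has at least three vertices. *)
  apply/negP => /conn_simple[[|z [|z' p]] [xp lp Up]].
  - by rewrite -lp eqxx in xy.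
  - by move: xp lp => /= /andP[+ _] zy; rewrite zy adj_del eqxx.
  apply: (acF [:: x, z, z' & p]) => //; apply/andP; split=> //.
  rewrite (cycle_path x) /= -[last _ p]/(last x [:: z, z' & p]) lp.
  rewrite adj_of_sym axy /=.
  apply: (@sub_path _ (adj_of (del F x y))) xp => c d.
  by rewrite adj_del => /andP[].
rewrite /cycle rcons_cons [path _ _ _]/= => /andP[xy /andP[yz zs]].
case/andP=> xU /andP[yU _].
have [xNy xNz] : x != y /\ x != z.
  by move: xU; rewrite !inE !negb_or => /and3P[].
move/negP: (fF x y xNy xy); apply.
rewrite conn_sym; apply: (@connect_trans _ _ z).
  apply: connect1; rewrite adj_del yz andbT.
  by apply/eqP => /eq_set2[] [? ?]; subst; rewrite eqxx in xNy xNz.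
rewrite delC -{2}(last_rcons z s x); apply: path_conn; apply: path_del => //.
by rewrite -rcons_cons mem_rcons inE eq_sym (negbTE xNy).
Qed.

(** Where the paths first diverge, to [y] and [z], the edge from [x] to [y] has a bypass: go to [z],
    follow the second path to the common end, return along the first. *)
Lemma forest_path_unique F x p q : forest F ->
  path (adj_of F) x p -> path (adj_of F) x q ->
  uniq (x :: p) -> uniq (x :: q) -> last x p = last x q -> p = q.
Proof.
move=> fF; elim: p x q => [|y p IH] x [|z q] //.
- move=> _ _ _ /andP[+ _] /= E; rewrite E => /negP[]; exact: mem_last.
- move=> _ _ /andP[+ _] _ /= E; rewrite -E => /negP[]; exact: mem_last.
move=> /= /andP[xy yp] /andP[xz zq] /andP[xNp Up] /andP[xNq Uq] E.
have [yz|yNz] := eqVneq y z.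
  by subst z; rewrite (IH y q).
have xNy : x != y by move: xNp; rewrite inE negb_or => /andP[].
case/negP: (fF x y xNy xy).
apply: (@connect_trans _ _ z).
  apply: connect1; rewrite adj_del xz andbT.
  by apply/eqP => /eq_set2[] [? ?]; subst; rewrite eqxx in xNy yNz.
apply: (@connect_trans _ _ (last z q)); first exact/path_conn/path_del.
by rewrite -E conn_sym; exact/path_conn/path_del.
Qed.

End EdgeSets.

(** * Consecutive pairs of a sequence *)

Section ConsecutivePairs.
Variable T : eqType.
Implicit Types (a b w : T) (p : seq T).

Lemma mem_zip_consec a b w p : (a, b) \in zip (w :: p) p ->
  exists p1 p2, w :: p = p1 ++ [:: a, b & p2].
Proof.
elim: p w => [|x p IH] w //=; rewrite inE => /orP[/eqP[-> ->]|/IH[p1 [p2 E]]].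
  by exists [::], p.
by exists (w :: p1), p2; rewrite E.
Qed.

Lemma consec_mem_zip a b w p p1 p2 :
  w :: p = p1 ++ [:: a, b & p2] -> (a, b) \in zip (w :: p) p.
Proof.
elim: p1 w p => [|x p1 IH] w p /= [-> ->]; first by rewrite /= inE eqxx.
case: p1 IH => [|y p1] IH; first by rewrite /= !inE eqxx orbT.
by rewrite /= inE; apply/orP; right; apply: IH.
Qed.

Lemma uniq_zip_consec w p : uniq (w :: p) -> uniq (zip (w :: p) p).
Proof.
elim: p w => [|x p IH] w //= /andP[wNp Up]; rewrite IH // andbT.
apply: contra wNp => /(map_f fst) /= /mapP[[c d] cd /= ->].
have [p1 [p2 E]] := mem_zip_consec cd.
by rewrite E mem_cat inE eqxx orbT.
Qed.

End ConsecutivePairs.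

(** * Paths to the root of a tree and the directed edges they traverse *)

Section RootPaths.
Variables (V : finType) (v : V) (T : {set {set V}}).
Hypotheses (Tf : forest T) (Tc : forall x, conn T x v).
Implicit Types (a b w x : V) (p : seq V).

Lemma root_pathP x : is_root_path v T x (root_path v T x).
Proof.
apply: (@xgetPex _ [::] [set p | is_root_path v T x p]%classic).
by have [p ?] := conn_simple (Tc x); exists p.
Qed.

Lemma root_path_eq x p : is_root_path v T x p -> root_path v T x = p.
Proof.
move=> [xp lp Up]; have [xq lq Uq] := root_pathP x.
by apply: (forest_path_unique Tf xq xp) => //; rewrite lq lp.
Qed.

Lemma root_path_suffix w p1 a p2 : w :: root_path v T w = p1 ++ a :: p2 ->
  root_path v T a = p2.
Proof.
move=> E; apply: root_path_eq; have [wp lp Up] := root_pathP w; split.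
- have : sorted (adj_of T) (w :: root_path v T w) by [].
  by rewrite E => /cat_sorted2[].
- by rewrite -lp -[RHS]/(last w (w :: root_path v T w)) E last_cat.
- by move: Up; rewrite E cat_uniq => /and3P[].
Qed.

(** Turns the tests in [sigma] into traversal of [(a, b)] by the path from [w]: from [a] on, this
    path is the root path of [a]. *)
Lemma par_subtree_edge w a b :
  (par v T a == Some b) && (w \in subtree v T a) =
  ((a, b) \in root_path_edges v T w).
Proof.
apply/idP/idP => [/andP[/eqP pa]|/mem_zip_consec[p1 [p2 E]]].
  rewrite inE => aw.
  have [p1 [p2 E]] : exists p1 p2, w :: root_path v T w = p1 ++ a :: p2.
    by case/splitPr: aw => p1 p2; exists p1, p2.
  move: pa; rewrite /par (root_path_suffix E); case: p2 E => //= c p2 E [cb]; subst c.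
  exact: consec_mem_zip E.
rewrite /par (root_path_suffix E) eqxx /= inE E.
by rewrite mem_cat mem_head orbT.
Qed.

Lemma par_size a b : par v T a == Some b ->
  size (root_path v T a) = (size (root_path v T b)).+1.
Proof.
move=> pa; have : (a, b) \in root_path_edges v T a.
  by rewrite -par_subtree_edge pa inE mem_head.
case/mem_zip_consec => p1 [p2 E].
rewrite (root_path_suffix E).
by rewrite (@root_path_suffix a (rcons p1 a) b p2) // cat_rcons.
Qed.

Lemma par_asym a b : par v T a == Some b -> par v T b == Some a -> False.
Proof.
move=> /par_size E1 /par_size E2; move: E1; rewrite E2 => /eqP.
by rewrite -[X in X == _]addn0 -addn2 eqn_add2l.
Qed.

(** The parts of the path before and after the edge each omit one of its ends, so they survive the
    deletion. Conversely, simple paths from [w] to [a] and from [b] to [v] are disjoint because the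
    edge is a bridge; joined by it, they form the root path. *)
Lemma root_edge_conn w a b : a != b ->
  ((a, b) \in root_path_edges v T w) =
  [&& adj_of T a b, conn (del T a b) w a & conn (del T a b) b v].
Proof.
move=> ab; apply/idP/and3P => [/mem_zip_consec[p1 [p2 E]]|[Tab wa bv]].
  have [wp lp Up] := root_pathP w.
  have : sorted (adj_of T) (w :: root_path v T w) by [].
  have {lp} : last w (w :: root_path v T w) = v by [].
  move: Up; rewrite E last_cat -cat1s catA cats1 cat_uniq => /and3P[U1 Hn /=].
  case/andP => bN _ lp S.
  have bp1 : b \notin rcons p1 a.
    by apply: contra Hn => ?; apply/hasP; exists b; rewrite ?mem_head.
  have aN : a \notin b :: p2.
    by apply: contra Hn => ?; apply/hasP; exists a; rewrite // mem_rcons mem_head.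
  have [/= _ /andP[Tab bp2]] : sorted (adj_of T) (rcons p1 a) /\
     sorted (adj_of T) [:: a, b & p2].
    split; first by have [] := cat_sorted2 S.
    by move: S; rewrite cat_rcons => /cat_sorted2[].
  split=> //; last by rewrite -lp; exact/path_conn/path_del.
  case: p1 E S bp1 {U1 Hn} => [[-> _] _ _|_ p1 [<- _] S bp1]; first exact: connect0.
  have -> : a = last w (rcons p1 a) by rewrite last_rcons.
  rewrite delC last_rcons -[X in conn _ _ X](last_rcons w p1).
  apply: path_conn; apply: path_del => //.
  by have [] := cat_sorted2 S.
have [p1 [wp1 l1 U1]] := conn_simple wa.
have [p2 [bp2 l2 U2]] := conn_simple bv.
have sub : subrel (adj_of (del T a b)) (adj_of T).
  by move=> c d; rewrite adj_del => /andP[].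
have E : root_path v T w = p1 ++ b :: p2.
  apply: root_path_eq; split.
  - by rewrite cat_path (sub_path sub wp1) /= l1 Tab (sub_path sub bp2).
  - by rewrite last_cat.
  - rewrite -cat_cons cat_uniq U1 U2 andbT; apply/hasPn => x xb.
    apply/negP => xw; case/negP: (Tf ab Tab).
    apply: (@connect_trans _ _ w); first by rewrite conn_sym.
    apply: (@connect_trans _ _ x); first exact: path_connect wp1 _ xw.
    by rewrite conn_sym; exact: path_connect bp2 _ xb.
rewrite /root_path_edges E; apply: (@consec_mem_zip _ _ _ _ _ (belast w p1) p2).
by rewrite -cat_cons lastI l1 cat_rcons.
Qed.

End RootPaths.

(** * Spanning trees, separating forests, and the exchange of one edge *)

Section SpanningTrees.
Variables (V : finType) (e : rel V).
Hypotheses (e_sym : symmetric e) (e_irr : irreflexive e).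
Implicit Types (F T : {set {set V}}) (a b w x y v : V).

Lemma adj_edges F x y : F \subset edges e -> adj_of F x y -> e x y.
Proof.
move=> /fintype.subsetP sub /sub /imsetP[[c d]]; rewrite inE /= => cd.
by case/eq_set2 => [] [-> ->] //; rewrite e_sym.
Qed.

Lemma mem_edges a b : e a b -> [set a; b]%SET \in edges e.
Proof. by move=> ab; apply/imsetP; exists (a, b). Qed.

Lemma neq_of_edge a b : e a b -> a != b.
Proof. by apply: contraTneq => ->; rewrite e_irr. Qed.

Lemma spanning_treesP T : reflect
  [/\ T \subset edges e, forall x y, conn T x y & forest T]
  (T \in spanning_trees e).
Proof.
rewrite inE; apply: (iffP (asboolP _)) => [[? ? /acyclic_forest]|[? ? ?]] //.
by split=> //; apply/acyclic_forest.
Qed.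

Definition separates v w F := [/\ F \subset edges e, forest F, ~~ conn F w v
  & forall x, conn F w x || conn F v x].

Definition separating_forests v w : {set {set {set V}}} :=
  [set F | `[< separates v w F >]]%SET.

Lemma separating_forestsP v w F :
  reflect (separates v w F) (F \in separating_forests v w).
Proof. by rewrite inE; exact: asboolP. Qed.

Lemma separating_conn_root v w F x : F \in separating_forests v w ->
  conn F x v = ~~ conn F w x.
Proof.
case/separating_forestsP=> _ _ wv /(_ x); rewrite (conn_sym F x v).
case: (boolP (conn F w x)) => //= wx _; apply: contraNF wv => vx.
by apply: connect_trans wx _; rewrite conn_sym.
Qed.

Section Exchange.
Variables (v w a b : V).
Hypothesis ab : e a b.

Let through := [set T in spanning_trees e | (a, b) \in root_path_edges v T w]%SET.
Let cut := [set F in separating_forests v w | conn F w a & conn F b v]%SET.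

Lemma through_cut T : T \in through -> adj_of T a b /\ del T a b \in cut.
Proof.
rewrite inE => /andP[/spanning_treesP[sT cT fT]].
rewrite root_edge_conn ?neq_of_edge // => /and3P[Tab wa bv].
split=> //; rewrite inE wa bv !andbT; apply/separating_forestsP; split.
- exact: fintype.subset_trans (del_subset _ _ _) sT.
- exact: forest_subset (del_subset _ _ _) fT.
- apply: contra (fT a b (neq_of_edge ab) Tab) => wv.
  apply: (@connect_trans _ _ w); first by rewrite conn_sym.
  by apply: (connect_trans wv); rewrite conn_sym.
move=> x; case: (conn_delP a b (cT a x)) => [ax|[_ bx]|[_ ax]].
- by rewrite (connect_trans wa ax).
- by rewrite [conn _ v x](@connect_trans _ _ b) ?orbT // conn_sym.
- by rewrite (connect_trans wa ax).
Qed.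

Lemma cut_through F : F \in cut ->
  [set a; b]%SET \notin F /\ ([set a; b] |: F)%SET \in through.
Proof.
rewrite inE => /andP[/separating_forestsP[sF fF wv cF] /andP[wa bv]].
have Nab : ~~ conn F a b.
  by apply: contra wv => ?; apply: connect_trans bv; exact: connect_trans wa _.
have Fab : [set a; b]%SET \notin F.
  by apply: contra Nab => ?; exact: connect1.
split=> //; set T := (_ |: F)%SET.
have sFT : F \subset T by exact: finset.subsetUr.
have Tab : adj_of T a b by rewrite /adj_of !inE eqxx.
have delT : del T a b = F by rewrite /del finset.setU1K.
have wvT : conn T w v.
  apply: (connect_trans (conn_subset sFT wa)).
  by apply: (connect_trans (connect1 Tab)); exact: conn_subset bv.
have cT x y : conn T x y.
  suff H z : conn T w z by apply: connect_trans (H y); rewrite conn_sym.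
  have /orP[/(conn_subset sFT)//|/(conn_subset sFT)] := cF z.
  exact: connect_trans.
have fT : forest T.
  move=> x y xy Txy.
  have [/eqP E|NE] := boolP ([set x; y]%SET == [set a; b]%SET).
    rewrite /del E finset.setU1K //.
    by case/eq_set2: E => [] [-> ->]; rewrite // conn_sym.
  have Fxy : adj_of F x y by move: Txy; rewrite /adj_of !inE (negbTE NE).
  (* If [x] and [y] stay joined without their edge, either the connection avoids the edge [a b] and
     contradicts [forest F], or together with the edge [x y] it joins [a] to [b] in [F]. *)
  apply/negP => /(conn_delP a b).
  have -> : del (del T x y) a b = del F x y.
    by rewrite -delT /del !finset.setDDl [([set [set x; y]] :|: _)%SET]finset.setUC.
  have sxy := del_subset F x y.
  case=> [xy'|[/(conn_subset sxy) xa /(conn_subset sxy) bY]|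
             [/(conn_subset sxy) xb /(conn_subset sxy) aY]].
  - by case/negP: (fF x y xy Fxy).
  - case/negP: Nab; apply: (@connect_trans _ _ x); first by rewrite conn_sym.
    by apply: (connect_trans (connect1 Fxy)); rewrite conn_sym.
  - case/negP: Nab; apply: (connect_trans aY); apply: connect_trans xb.
    by rewrite conn_sym; exact: connect1.
rewrite inE; apply/andP; split.
  apply/spanning_treesP; split=> //.
  by rewrite finset.subUset finset.sub1set mem_edges.
by rewrite root_edge_conn ?neq_of_edge // delT Tab wa.
Qed.

(** Deleting and adding the edge are injective, as it lies in every tree of [through] and in no
    forest of [cut]; each map gives one inequality. *)
Lemma card_through_cut : #|through| = #|cut|.
Proof.
apply/eqP; rewrite eqn_leq; apply/andP; split.
  rewrite -(@card_in_imset _ _ (fun T => del T a b) through).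
    apply/subset_leq_card/fintype.subsetP => _ /imsetP[T /through_cut[_ +] ->].
    by [].
  move=> T T' /through_cut[aT _] /through_cut[aT' _] /= E.
  rewrite -(finset.setD1K (aT : [set a; b]%SET \in T)).
  rewrite -[in RHS](finset.setD1K (aT' : [set a; b]%SET \in T')).
  by rewrite -/(del T a b) E.
rewrite -(@card_in_imset _ _ (fun F => [set a; b] |: F)%SET cut).
  apply/subset_leq_card/fintype.subsetP => _ /imsetP[F /cut_through[_ +] ->].
  by [].
move=> F F' /cut_through[aF _] /cut_through[aF' _] /= E.
by rewrite -(finset.setU1K aF) -(finset.setU1K aF') E.
Qed.

End Exchange.
End SpanningTrees.

Local Open Scope ring_scope.

(** * Telescoping sums and sums of indicators *)

Lemma telescope_zip (M : zmodType) (V : Type) (g : V -> M) (w : V) (p : seq V) :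
  \sum_(ab <- zip (w :: p) p) (g ab.1 - g ab.2) = g w - g (last w p).
Proof.
elim: p w => [|x p IH] w; first by rewrite /= big_nil subrr.
by rewrite [zip _ _]/= big_cons IH /= addrA subrK.
Qed.

Lemma sum_eq_nat (R : nzRingType) (I : finType) (P : pred I) (i : I) :
  \sum_(j | P j) (i == j)%:R = (P i)%:R :> R.
Proof.
rewrite big_mkcond (bigD1 i) //= big1 => [|j ij]; last first.
  by rewrite eq_sym (negbTE ij); case: ifP.
by rewrite eqxx addr0; case: (P i).
Qed.

Lemma mem_uniq_sum (R : nzRingType) (I : eqType) (s : seq I) (i : I) : uniq s ->
  (i \in s)%:R = \sum_(j <- s) (j == i)%:R :> R.
Proof.
by move=> Us; rewrite -count_uniq_mem // -sum1_count big_mkcond natr_sum /=;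
  apply: eq_bigr => j _; case: (j == i).
Qed.

Lemma sum_nat_card (R : nzRingType) (I : finType) (A : {set I}) (P : pred I) :
  \sum_(i in A) (P i)%:R = #|[set i in A | P i]%SET|%:R :> R.
Proof.
rewrite -natr_sum -big_mkcondr -sum1_card; congr (_%:R); apply: eq_bigl => i.
by rewrite finset.in_set.
Qed.

(** * Sums over all spanning trees, and bounds for a single tree *)

Section UniformTree.
Variables (R : realType) (V : finType) (e : rel V).
Hypotheses (e_sym : symmetric e) (e_irr : irreflexive e).
Implicit Types (F T B : {set {set V}}) (a b w x y u v : V).
Local Notation trees := (spanning_trees e).
Local Notation n := #|V|.

(** Two vertices are never parents of each other, so the nested tests exclude one another. *)
Lemma sigmaE v T w a b : T \in trees ->
  sigma R v T w (a, b) = ((a, b) \in root_path_edges v T w)%:R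
                       - ((b, a) \in root_path_edges v T w)%:R.
Proof.
case/spanning_treesP=> _ cT fT; have cv x := cT x v; rewrite /sigma /=.
rewrite !(par_subtree_edge fT cv).
have [E|_] := boolP (_ \in _); last first.
  by case: (_ \in _); rewrite ?subr0 ?sub0r ?oppr0.
have [E'|_] := boolP ((b, a) \in _); last by rewrite subr0.
move: E E'; rewrite -!(par_subtree_edge fT cv) => /andP[pa _] /andP[pb _].
by case: (par_asym fT cv pa pb).
Qed.

(** The size of a subtree counts the vertices [w] whose root path leaves through its top, so [flow]
    is the mean of [sigma] over [w]. *)
Lemma flowE v T ab : T \in trees ->
  flow R v T ab = n%:R^-1 * \sum_w sigma R v T w ab.
Proof.
case: ab => a b /spanning_treesP[_ cT fT]; have cv x := cT x v.
have H (A : {set V}) : #|A|%:R / n%:R = n%:R^-1 * \sum_w (w \in A)%:R :> R.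
  rewrite mulrC; congr (_ * _); rewrite -natr_sum; congr (_%:R).
  by rewrite -big_mkcond sum1_card.
rewrite /flow /sigma /=; case: ifP => [pa|_ /=].
  rewrite H; congr (_ * _); apply: eq_bigr => w _; rewrite [true && _]/=.
  case: (w \in subtree v T a) => //.
  case: ifP => // /andP[pb _]; case: (par_asym fT cv pa pb).
case: ifP => [pb|_ /=]; last by rewrite big1 ?mulr0.
rewrite H -mulrN -sumrN; congr (_ * _); apply: eq_bigr => w _.
by case: (w \in subtree v T b) => //; rewrite oppr0.
Qed.

Lemma root_path_edges_adj v B u a b : B \in trees ->
  (a, b) \in root_path_edges v B u -> e a b.
Proof.
case/spanning_treesP=> sB cB _; have cv x := cB x v.
have [up _ _] := root_pathP cv u.
case/mem_zip_consec=> p1 [p2 E].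
have : sorted (adj_of B) (u :: root_path v B u) by [].
by rewrite E => /cat_sorted2[_] /= /andP[+ _]; exact: adj_edges.
Qed.

(** A path enters and leaves each inner vertex equally often, so only its ends contribute. *)
Lemma sigma_node_law v T w a : T \in trees ->
  \sum_(b | e a b) sigma R v T w (a, b) = (w == a)%:R - (v == a)%:R.
Proof.
move=> tT; have [sT cT fT] := spanning_treesP e T tT; have cv x := cT x v.
have [wp lp Up] := root_pathP cv w.
under eq_bigr => b _ do
  rewrite sigmaE // !mem_uniq_sum ?uniq_zip_consec // -sumrB.
rewrite exchange_big /=.
(* The right-hand side also becomes a telescoping sum along the root path, and the two sums are
   compared edge by edge. *)
rewrite -[in (v == a)]lp -(telescope_zip (fun c => (c == a)%:R : R)).
rewrite !big_seq; apply: eq_bigr => -[c d] cd /=.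
have ecd : e c d := root_path_edges_adj tT cd.
under eq_bigr => b _ do rewrite !xpair_eqE.
rewrite sumrB; congr (_ - _).
  have [<-|_] := eqVneq c a; last by rewrite big1.
  by rewrite /= sum_eq_nat ecd.
have [<-|_] := eqVneq d a; last by rewrite big1 // => b _; rewrite andbF.
under eq_bigr do rewrite andbT.
by rewrite sum_eq_nat e_sym ecd.
Qed.

(* Up to the factor [#|trees|], the potential of a unit current from [w] to [v]. *)
Definition potential v w x : R :=
  #|[set F in separating_forests e v w | conn F w x]%SET|%:R.

Lemma potential_root v w : potential v w v = 0.
Proof.
rewrite /potential (_ : [set _ in _ | _]%SET = finset.set0) ?cards0 //.
apply/setP => F; rewrite !inE; apply/negbTE/negP => /andP[sF wv].
have [_ _] := asboolP _ sF.
by rewrite wv.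
Qed.

Lemma sum_sigma v w a b : e a b ->
  \sum_(T in trees) sigma R v T w (a, b) = potential v w a - potential v w b.
Proof.
move=> ab.
(* The edge exchange turns the count of trees that use [(c, d)] into a count of forests with [c],
   but not [d], on the side of [w]. *)
have H c d : e c d -> \sum_(T in trees) ((c, d) \in root_path_edges v T w)%:R =
   \sum_(F in separating_forests e v w) (conn F w c && ~~ conn F w d)%:R :> R.
  move=> cd; rewrite sum_nat_card card_through_cut // -sum_nat_card.
  by apply: eq_bigr => F sF; rewrite (separating_conn_root _ sF).
transitivity (\sum_(T in trees) (((a, b) \in root_path_edges v T w)%:R
                       - ((b, a) \in root_path_edges v T w)%:R) : R).
  by apply: eq_bigr => T tT; exact: sigmaE.
rewrite sumrB !H //; last by rewrite e_sym.
rewrite -sumrB /potential.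
rewrite -!sum_nat_card -sumrB; apply: eq_bigr => F _.
by case: (conn F w a); case: (conn F w b); rewrite /= ?subrr ?subr0.
Qed.

Lemma potential_node_law v w a :
  \sum_(b | e a b) (potential v w a - potential v w b) =
  #|trees|%:R * ((w == a)%:R - (v == a)%:R).
Proof.
under eq_bigr => b ab do rewrite -sum_sigma //.
rewrite exchange_big /=.
under eq_bigr => T tT do rewrite sigma_node_law //.
by rewrite sumr_const mulr_natl.
Qed.

Lemma telescope_root_path (M : zmodType) (g : V -> M) v B u : B \in trees ->
  \sum_(ab <- root_path_edges v B u) (g ab.1 - g ab.2) = g u - g v.
Proof.
case/spanning_treesP=> _ cB _; have cv x := cB x v.
by rewrite telescope_zip; have [_ ->] := root_pathP cv u.
Qed.

(** The edges of [B] are edges of the graph, so each contributes a potential difference; these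
    telescope to the root, where the potential vanishes. *)
Lemma sum_x1 v B u : B \in trees ->
  \sum_(T in trees) x1 R v B T u = potential v u u.
Proof.
move=> tB; rewrite /x1 exchange_big /=.
have := telescope_root_path (potential v u) v u tB.
rewrite potential_root subr0 => <-.
rewrite big_seq [RHS]big_seq; apply: eq_bigr => -[a b] ab.
by rewrite sum_sigma //; exact: root_path_edges_adj ab.
Qed.

Lemma sum_x2 v B u : B \in trees ->
  \sum_(T in trees) x2 R v B T u = n%:R^-1 * \sum_w potential v w u.
Proof.
move=> tB; rewrite /x2 exchange_big /=.
transitivity (\sum_(ab <- root_path_edges v B u)
   (n%:R^-1 * \sum_w potential v w ab.1 - n%:R^-1 * \sum_w potential v w ab.2)).
  rewrite big_seq [RHS]big_seq; apply: eq_bigr => -[a b] ab.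
  under eq_bigr => T tT do rewrite flowE //.
  rewrite -mulr_sumr exchange_big /= -mulrBr -sumrB; congr (_ * _).
  apply: eq_bigr => w _; apply: sum_sigma; exact: root_path_edges_adj ab.
rewrite (telescope_root_path (fun x => n%:R^-1 * \sum_w potential v w x)) //.
rewrite [X in _ - _ * X]big1 ?mulr0 ?subr0 // => w _; exact: potential_root.
Qed.

Lemma sigma_bound v T w ab : `|sigma R v T w ab| <= 1.
Proof.
by rewrite /sigma; case: ifP => _; [|case: ifP => _]; rewrite ?normrN ?normr1 ?normr0.
Qed.

Lemma card_ratio_itv (A : {set V}) : 0 <= (#|A|%:R / n%:R : R) <= 1.
Proof.
(* For empty [V] the quotient is zero, as the inverse of zero is zero. *)
rewrite divr_ge0 //=; have [->|n0] := eqVneq n 0%N; first by rewrite invr0 mulr0.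
by rewrite ler_pdivrMr ?ltr0n ?lt0n // mul1r ler_nat max_card.
Qed.

Lemma flow_bound v T ab : `|flow R v T ab| <= 1.
Proof.
rewrite /flow; case: ifP => _; [|case: ifP => _]; rewrite ?normrN ?normr0 //.
all: by case/andP: (card_ratio_itv (subtree v T ab.1)) => ? ?;
  case/andP: (card_ratio_itv (subtree v T ab.2)) => ? ?; rewrite ger0_norm.
Qed.

(* [sigma] and [flow] have the same sign. *)
Lemma sigma_flow_bound v T w ab : T \in trees ->
  `|sigma R v T w ab - 2 * flow R v T ab| <= 2.
Proof.
case/spanning_treesP=> _ cT fT; have cv x := cT x v.
have asym := par_asym fT cv (a := ab.1) (b := ab.2).
rewrite /sigma /flow; case/andP: (card_ratio_itv (subtree v T ab.1)) => A0 A1.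
case/andP: (card_ratio_itv (subtree v T ab.2)) => B0 B1.
rewrite ler_norml; move: asym; case: (par v T ab.1 == _) => /= asym.
  case: ifP => _; first by apply/andP; split; lra.
  by case: ifP => [/andP[/(asym isT)]|_] //; apply/andP; split; lra.
by case: (par v T ab.2 == _) => /=; [case: ifP|]=> *; apply/andP; split; lra.
Qed.

End UniformTree.

(** * Shortest walks and Lipschitz functions *)

Section Distances.
Variables (V : finType) (e : rel V).
Implicit Types x y : V.

Lemma gdist_walk x y : connect e x y ->
  exists p, [/\ path e x p, last x p = y & size p = gdist e x y].
Proof.
case/connectP=> q /shortenP[p xp Up _] lp.
(* A simple path has fewer than [#|V|] edges, so the search behind [gdist] succeeds before its
   default value. *)
have hp : has (walk_of_length e x y) (iota 0 #|V|).
  apply/hasP; exists (size p); last first.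
    by apply/existsP; exists (in_tuple p); rewrite xp lp eqxx.
  by rewrite mem_iota add0n; have := max_card (mem (x :: p)); rewrite (card_uniqP Up).
have := nth_find 0%N hp; rewrite -/(gdist e x y) nth_iota; last first.
  by move: hp; rewrite has_find size_iota.
rewrite add0n => /existsP[r /andP[xr /eqP lr]].
by exists r; split=> //; rewrite size_tuple.
Qed.

Lemma gdist_le_diameter x y : (gdist e x y <= diameter e)%N.
Proof.
apply: leq_trans (leq_bigmax x); exact: (leq_bigmax (F := gdist e x) y).
Qed.

Lemma lipschitz_gdist (R : realType) (g : V -> R) (c : R) x y : connect e x y ->
  (forall a b, e a b -> `|g a - g b| <= c) ->
  `|g x - g y| <= c *+ gdist e x y.
Proof.
move=> /gdist_walk[p [xp <- <-]] H.
elim: p x xp => [|z p IH] x /=; first by rewrite subrr normr0.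
case/andP=> xz zp; rewrite mulrS -(subrKA (g z)).
by apply: le_trans (ler_normD _ _) _; apply: lerD; [exact: H|exact: IH].
Qed.

End Distances.

(** * The Laplacian, its pseudo-inverse and Green functions *)

Section LaplacianPseudoInverse.
Variables (R : realType) (V : finType) (e : rel V).
Hypotheses (e_sym : symmetric e) (e_conn : connected_graph e).
Local Notation n := #|V|.
Local Notation L := (laplacian R e).
Local Notation M := (moore_penrose L).

Lemma sum_enum_val (F : V -> R) : \sum_(j < n) F (enum_val j) = \sum_x F x.
Proof. by rewrite [RHS](reindex _ (onW_bij _ (enum_val_bij V))). Qed.

Lemma laplacian_mul (g : V -> R) (i : 'I_n) :
  (L *m \col_j g (enum_val j)) i 0 =
  \sum_(b | e (enum_val i) b) (g (enum_val i) - g b).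
Proof.
rewrite /laplacian mulmxBl mul_diag_mx 3!mxE !mxE sumrB; congr (_ - _).
  rewrite sumr_const mulr_natl; congr (_ *+ _).
  by apply: eq_card => x; rewrite !inE.
rewrite [RHS]big_mkcond -sum_enum_val; apply: eq_bigr => j _.
by rewrite !mxE; case: ifP; rewrite ?mul1r ?mul0r.
Qed.

Lemma laplacian_tr : L^T = L.
Proof.
rewrite /laplacian linearB /= tr_diag_mx; congr (_ - _).
by apply/matrixP => i j; rewrite !mxE e_sym.
Qed.

Lemma laplacian_const (c : R) : L *m const_mx c = 0 :> 'cV_n.
Proof.
rewrite (_ : const_mx c = \col_j (fun=> c) (enum_val j)); last first.
  by apply/matrixP => i j; rewrite !mxE.
apply/matrixP => i j; rewrite ord1 laplacian_mul mxE big1 // => b _.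
exact: subrr.
Qed.

(* Maximum principle: the set where a harmonic function is maximal is closed
   under adjacency. *)
Lemma harmonic_const (g : V -> R) :
  (forall a, \sum_(b | e a b) (g a - g b) = 0) -> forall x y, g x = g y.
Proof.
move=> H x y.
have [m _ Hm] := @arg_maxP _ R V x xpredT g isT.
suff E z : g z = g m by rewrite !E.
have clm : fingraph.closed e [pred z | g z == g m].
  apply: intro_closed; first exact: sym_connect_sym.
  move=> a b ab; rewrite !inE => /eqP am.
  have /eqP := H a; rewrite psumr_eq0 => [/allP/(_ b (mem_index_enum _))|c _].
    by rewrite ab /= subr_eq0 am eq_sym.
  by rewrite subr_ge0 am; exact: Hm.
have := closed_connect clm (e_conn m z); rewrite !inE eqxx.
by move/esym/eqP.
Qed.

Lemma pinv_tr : M^T = M.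
Proof.
apply: (is_moore_penrose_unique (A := L)) (moore_penroseP L).
have [E1 E2 E3 E4] := moore_penroseP L; split.
- by have := congr1 trmx E1; rewrite !trmx_mul laplacian_tr mulmxA.
- by have := congr1 trmx E2; rewrite !trmx_mul laplacian_tr mulmxA.
- by rewrite trmx_mul trmxK laplacian_tr -E4 trmx_mul laplacian_tr.
- by rewrite trmx_mul trmxK laplacian_tr -E3 trmx_mul laplacian_tr.
Qed.

(** As [L M] is symmetric, it equals [M^T L]; hence [M = M M^T L] kills the constants, as [L]
    does. *)
Lemma pinv_const (c : R) : M *m const_mx c = 0 :> 'cV_n.
Proof.
have [_ E2 E3 _] := moore_penroseP L.
rewrite -E2 -!mulmxA [L *m (M *m _)]mulmxA -E3 trmx_mul laplacian_tr -mulmxA.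
by rewrite laplacian_const !mulmx0.
Qed.

Definition Lpinv (u w : V) : R := M (enum_rank u) (enum_rank w).

Lemma pinv_sym u w : Lpinv u w = Lpinv w u.
Proof. by rewrite /Lpinv -{1}pinv_tr mxE. Qed.

Lemma pinv_row_sum u : \sum_w Lpinv u w = 0.
Proof.
have /matrixP/(_ (enum_rank u) 0) := pinv_const 1.
rewrite !mxE => E; rewrite -sum_enum_val -[RHS]E; apply: eq_bigr => j _.
by rewrite mxE mulr1 /Lpinv enum_valK.
Qed.

(** The vector [d] lies in the range of [L], so [L M d = d]. Thus [phi] and [M d] differ by a
    harmonic function, that is, by a constant, which [phi v = 0] determines. *)
Lemma green_function (phi : V -> R) (v w : V) :
  (forall a, \sum_(b | e a b) (phi a - phi b) = (w == a)%:R - (v == a)%:R) ->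
  phi v = 0 ->
  forall u, phi u = Lpinv u w - Lpinv u v - Lpinv v w + Lpinv v v.
Proof.
move=> H phiv u.
pose d : 'cV[R]_n := delta_mx (enum_rank w) 0 - delta_mx (enum_rank v) 0.
pose y : 'cV[R]_n := \col_j phi (enum_val j).
have Ly : L *m y = d.
  apply/matrixP => i j; rewrite ord1 laplacian_mul H !mxE eqxx !andbT.
  by rewrite -!(can2_eq enum_rankK enum_valK) ![enum_rank _ == _]eq_sym.
have Md x : (M *m d) (enum_rank x) 0 = Lpinv x w - Lpinv x v.
  by rewrite mulmxBr -!colE !mxE.
have [E1 _ _ _] := moore_penroseP L.
pose z x := phi x - (Lpinv x w - Lpinv x v).
have Lz : L *m (\col_j z (enum_val j)) = 0.
  rewrite (_ : \col_j _ = y - M *m d); last first.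
    by apply/matrixP => i j; rewrite ord1 mxE /z -Md enum_valK !mxE.
  by rewrite mulmxBr -Ly !mulmxA E1 subrr.
have : z u = z v.
  apply: harmonic_const => a; have /matrixP/(_ (enum_rank a) 0) := Lz.
  by rewrite laplacian_mul mxE enum_rankK.
rewrite /z phiv; lra.
Qed.

(** Since rows of [M] sum to zero, the mean of [phi w x] over [w] is [Lpinv v v - Lpinv x v], and
    averaging over [x] as well leaves [Lpinv v v]. In the combination all terms with [v] cancel. *)
Lemma pinv_diag (phi : V -> V -> R) (v : V) :
  (forall w a, \sum_(b | e a b) (phi w a - phi w b) =
     (w == a)%:R - (v == a)%:R) ->
  (forall w, phi w v = 0) ->
  forall u, phi u u - 2 * (n%:R^-1 * \sum_w phi w u)
    + n%:R^-1 * \sum_z (n%:R^-1 * \sum_w phi w z) = Lpinv u u.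
Proof.
move=> H phiv u.
have n0 : n%:R != 0 :> R.
  by rewrite pnatr_eq0 -lt0n; apply/card_gt0P; exists v.
have E w x : phi w x = Lpinv x w - Lpinv x v - Lpinv v w + Lpinv v v.
  exact: green_function.
have mean x : n%:R^-1 * \sum_w phi w x = Lpinv v v - Lpinv x v.
  under eq_bigr => w _ do rewrite E.
  rewrite big_split /= sumrB sumrB (pinv_row_sum x) (pinv_row_sum v).
  rewrite !sumr_const -[Lpinv x v *+ _]mulr_natl -[Lpinv v v *+ _]mulr_natl.
  by field.
rewrite mean (eq_bigr _ (fun z _ => mean z)) E sumrB sumr_const.
rewrite (eq_bigr _ (fun z _ => pinv_sym z v)) pinv_row_sum.
rewrite -[Lpinv v v *+ _]mulr_natl (pinv_sym v u).
by field.
Qed.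

End LaplacianPseudoInverse.

(** * One sample of the estimator: its mean and its range *)

Section TreeEstimator.
Variables (R : realType) (V : finType) (e : rel V).
Hypotheses (e_sym : symmetric e) (e_irr : irreflexive e).
Hypothesis e_conn : connected_graph e.
Implicit Types (T B : {set {set V}}) (u v w z : V).
Local Notation trees := (spanning_trees e).
Local Notation n := #|V|.

Definition tree_sample v B T u : R :=
  x1 R v B T u - 2 * x2 R v B T u + n%:R^-1 * \sum_w x2 R v B T w.

Lemma mean_bound (F : V -> R) (c : R) : 0 <= c ->
  (forall z, `|F z| <= c) -> `|n%:R^-1 * \sum_z F z| <= c.
Proof.
move=> c0 Fc; rewrite normrM ger0_norm ?invr_ge0 //.
have [n0|n0] := eqVneq n 0%N; first by rewrite n0 invr0 mul0r.
rewrite ler_pdivrMl ?ltr0n ?lt0n //.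
apply: le_trans (ler_norm_sum _ _ _) _.
apply: le_trans (ler_sum _ (fun z _ => Fc z)) _.
by rewrite sumr_const mulr_natl.
Qed.

(** A path of a BFS tree is shortest, so it has at most [diameter e] edges. *)
Lemma path_sum_bound (F : V * V -> R) (c : R) v B u : is_bfs_tree v e B ->
  0 <= c -> (forall ab, `|F ab| <= c) ->
  `|\sum_(ab <- root_path_edges v B u) F ab| <= c * (diameter e)%:R.
Proof.
move=> [_ sB] c0 Fc; apply: le_trans (ler_norm_sum _ _ _) _.
apply: le_trans (ler_sum _ (fun ab _ => Fc ab)) _.
rewrite big_const_seq count_predT iter_addr_0 size2_zip ?leqnSn //.
by rewrite -[c *+ _]mulr_natr ler_wpM2l // ler_nat sB gdist_le_diameter.
Qed.

Lemma tree_sample_bound v B T u : is_bfs_tree v e B -> T \in trees ->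
  `|tree_sample v B T u| <= 3 * (diameter e)%:R.
Proof.
move=> bfs tT; set D := (diameter e)%:R.
have H1 : `|x1 R v B T u - 2 * x2 R v B T u| <= 2 * D.
  rewrite /x1 /x2 mulr_sumr -sumrB; apply: path_sum_bound => // ab.
  exact: sigma_flow_bound tT.
have H2 : `|n%:R^-1 * \sum_w x2 R v B T w| <= D.
  apply: mean_bound => // w; rewrite -[leRHS]mul1r; apply: path_sum_bound => // ab.
  exact: flow_bound.
by apply: le_trans (ler_normD _ _) _; apply: le_trans (lerD H1 H2) _; lra.
Qed.

Definition voltage v w x : R := #|trees|%:R^-1 * potential R e v w x.

Lemma voltage_root v w : voltage v w v = 0.
Proof. by rewrite /voltage potential_root mulr0. Qed.

Section NonEmpty.
Hypothesis trees_gt0 : (0 < #|trees|)%N.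

Lemma voltage_node_law v w a :
  \sum_(b | e a b) (voltage v w a - voltage v w b) = (w == a)%:R - (v == a)%:R.
Proof.
under eq_bigr do rewrite /voltage -mulrBr.
by rewrite -mulr_sumr potential_node_law // mulKf // pnatr_eq0 -lt0n.
Qed.

(** The voltage drop along an edge is the mean of [sigma] over all trees. *)
Lemma voltage_edge v w a b : e a b -> `|voltage v w a - voltage v w b| <= 1.
Proof.
move=> ab; rewrite /voltage -mulrBr -sum_sigma // normrM ger0_norm ?invr_ge0 //.
rewrite ler_pdivrMl ?ltr0n // mulr1.
apply: le_trans (ler_norm_sum _ _ _) _.
apply: le_trans (ler_sum _ (fun T _ => sigma_bound _ v T w (a, b))) _.
by rewrite sumr_const.
Qed.

(* The value at the diagonal does not depend on the root; rooting at [u] makes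
   it an average of voltages, which vary by at most one along each edge. *)
Lemma pinv_diag_bound u : `|Lpinv R e u u| <= (diameter e)%:R.
Proof.
have H := pinv_diag e_sym e_conn (voltage_node_law u) (voltage_root u) u.
rewrite -H voltage_root [X in _ - _ * (_ * X)]big1; last first.
  by move=> w _; exact: voltage_root.
rewrite !mulr0 subr0 add0r.
apply: mean_bound => // z; apply: mean_bound => // w.
rewrite -[voltage _ _ _]subr0 -(voltage_root u w).
apply: le_trans (lipschitz_gdist (e_conn z u) (voltage_edge u w)) _.
by rewrite ler_nat gdist_le_diameter.
Qed.

(** Unbiasedness of one sample, in the centred form that the concentration bound takes: [sum_x1] and
    [sum_x2] produce exactly the combination of [pinv_diag]. *)
Lemma sum_tree_sample v B u : B \in trees ->
  \sum_(T in trees) (tree_sample v B T u - Lpinv R e u u) = 0.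
Proof.
move=> tB; rewrite sumrB.
have -> : \sum_(T in trees) tree_sample v B T u = \sum_(T in trees) x1 R v B T u
    - 2 * (\sum_(T in trees) x2 R v B T u)
    + n%:R^-1 * \sum_w \sum_(T in trees) x2 R v B T w.
  rewrite big_split sumrB /= -!mulr_sumr; congr (_ + _ * _); exact: exchange_big.
rewrite sum_x1 // (eq_bigr _ (fun w _ => sum_x2 R e_sym e_irr v w tB)) sum_x2 //.
rewrite -(pinv_diag e_sym e_conn (voltage_node_law v) (voltage_root v) u).
rewrite sumr_const -[X in _ - X]mulr_natl /voltage.
have E z : n%:R^-1 * \sum_w #|trees|%:R^-1 * potential R e v w z =
   #|trees|%:R^-1 * (n%:R^-1 * \sum_w potential R e v w z).
  by rewrite -mulr_sumr mulrCA.
rewrite E (eq_bigr _ (fun z _ => E z)) -!mulr_sumr.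
have N0 : #|trees|%:R != 0 :> R by rewrite pnatr_eq0 -lt0n.
have n0 : n%:R != 0 :> R by rewrite pnatr_eq0 -lt0n; apply/card_gt0P; exists v.
by field; apply/andP.
Qed.

End NonEmpty.
End TreeEstimator.

(** * Inequalities for the exponential function *)

Lemma derive_ge0_le (R : realType) (f df : R -> R) (t : R) :
  (forall x : R, is_derive x 1 f (df x)) -> (forall x, 0 <= x -> 0 <= df x) ->
  0 <= t -> f 0 <= f t.
Proof.
move=> fdf df0 t0.
have [|c] := MVT_segment t0 (fun x _ => fdf x).
  by apply: derivable_within_continuous => x _; exact: ex_derive.
rewrite in_itv /= => /andP[c0 _] E.
by rewrite -subr_ge0 E subr0 mulr_ge0 // df0.
Qed.

(** The difference of the two sides vanishes at zero and has derivative [x * (expR x - expR (- x))],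
    which is nonnegative for [x >= 0]. *)
Lemma sinh_le_cosh (R : realType) (t : R) : 0 <= t ->
  expR t - expR (- t) <= t * (expR t + expR (- t)).
Proof.
move=> t0.
pose f x : R := x * (expR x + expR (- x)) - (expR x - expR (- x)).
have fdf (x : R) : is_derive x 1 f (x * (expR x - expR (- x))).
  apply: is_derive_eq.
  rewrite /GRing.scale /=; ring.
have := derive_ge0_le fdf _ t0; rewrite /f oppr0 subrr mul0r subr0 subr_ge0.
apply=> x x0; rewrite mulr_ge0 // subr_ge0 ler_expR; lra.
Qed.

(** By evenness let [t >= 0]. The product of [expR (- (x ^+ 2 / 2))] and [expR x + expR (- x)]
    decreases from its value 2 at zero, by [sinh_le_cosh]; [f] is its negative. *)
Lemma cosh_le_expR_sqr (R : realType) (t : R) :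
  (expR t + expR (- t)) / 2 <= expR (t ^+ 2 / 2).
Proof.
wlog t0 : t / 0 <= t.
  have [?|/ltW t0] := leP 0 t; first exact.
  by move=> /(_ (- t)); rewrite opprK sqrrN addrC; apply; rewrite oppr_ge0.
pose f x : R := - (expR (- (x ^+ 2 / 2)) * (expR x + expR (- x))).
have fdf (x : R) : is_derive x 1 f (expR (- (x ^+ 2 / 2)) *
    (x * (expR x + expR (- x)) - (expR x - expR (- x)))).
  apply: is_derive_eq.
  by rewrite /GRing.scale /=; field.
have := derive_ge0_le fdf _ t0; rewrite /f oppr0 expr0n /= mul0r oppr0 expR0 mul1r.
rewrite lerN2 => H; rewrite ler_pdivrMr // -ler_pdivrMl ?expR_gt0 // -expRN.
by apply: H => x x0; rewrite mulr_ge0 ?expR_ge0 // subr_ge0 sinh_le_cosh.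
Qed.

Lemma expR_chord (R : realType) (l c y : R) : 0 < c -> `|y| <= c ->
  expR (l * y) <= (expR (l * c) + expR (- (l * c))) / 2
    + y * ((expR (l * c) - expR (- (l * c))) / 2 / c).
Proof.
move=> c0; rewrite ler_norml => /andP[yl yr].
(* The weight of the end [c] when [y] is a convex combination of [c] and [- c]. *)
have t01 : 0 <= (1 + y / c) / 2 <= 1.
  have : -1 <= y / c <= 1 by rewrite ler_pdivlMr // ler_pdivrMr // mulN1r mul1r yl.
  by move=> /andP[? ?]; apply/andP; split; lra.
pose t : {i01 R} := Itv01 (proj1 (andP t01)) (proj2 (andP t01)).
have := convex_expR t (l * c) (- (l * c)).
rewrite !convRE /= /unstable.onem => H; apply: le_trans (le_trans _ H) _.
  by rewrite le_eqVlt; apply/orP; left; apply/eqP; congr expR; field; exact: lt0r_neq0.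
by rewrite le_eqVlt; apply/orP; left; apply/eqP; field; exact: lt0r_neq0.
Qed.

(** * Hoeffding's bound as a count of tuples *)

Section Hoeffding.
Variables (R : realType) (S : finType) (D : {set S}) (Y : S -> R) (c : R).
Hypotheses (c_gt0 : 0 < c) (Y_mean0 : \sum_(s in D) Y s = 0).
Hypothesis Y_bound : forall s, s \in D -> `|Y s| <= c.

Lemma sum_expR_le (l : R) :
  \sum_(s in D) expR (l * Y s) <= #|D|%:R * expR ((l * c) ^+ 2 / 2).
Proof.
apply: le_trans (ler_sum _ (fun s sD => expR_chord l c_gt0 (Y_bound sD))) _.
rewrite big_split /= sumr_const -mulr_suml Y_mean0 mul0r addr0 mulr_natl.
by rewrite lerMn2r cosh_le_expR_sqr orbT.
Qed.

Lemma hoeffding_count (k : nat) (eps : R) : 0 <= eps ->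
  #|[set f : {ffun 'I_k -> S} | (f \in ffun_on (mem D)) &&
       (k%:R * eps < \sum_i Y (f i))]%SET|%:R <=
  #|D|%:R ^+ k * expR (- (k%:R * eps ^+ 2 / (2 * c ^+ 2))).
Proof.
(* This [l] minimizes the exponent [(l * c) ^+ 2 / 2 - l * eps] of the Chernoff bound. *)
move=> eps0; pose l := eps / c ^+ 2.
have l0 : 0 <= l by rewrite divr_ge0 // sqr_ge0.
apply: (@le_trans _ _ (\sum_(f : {ffun 'I_k -> S} | f \in ffun_on (mem D))
    expR (l * (\sum_i Y (f i) - k%:R * eps)))).
  rewrite -sum1_card natr_sum big_mkcond [leRHS]big_mkcond.
  apply: ler_sum => f _; rewrite finset.in_set; case: ifP => /=.
    case/andP=> -> H; apply: le_trans (expR_ge1Dx _).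
    by rewrite mulr1n lerDl mulr_ge0 // subr_ge0 ltW.
  by case: ifP => _ _ //; exact: expR_ge0.
under eq_bigr => f _ do rewrite mulrBr expRB mulr_sumr expR_sum.
(* A sum over tuples of a product over coordinates is a power of the sum over [D]; this replaces
   independence. *)
rewrite -mulr_suml -(bigA_distr_big (mem D) (fun _ s => expR (l * Y s))).
rewrite prodr_const card_ord.
have H := sum_expR_le l.
apply: (@le_trans _ _ ((#|D|%:R * expR ((l * c) ^+ 2 / 2)) ^+ k
    / expR (l * (k%:R * eps)))).
  rewrite ler_wpM2r ?invr_ge0 ?expR_ge0 // lerXn2r // nnegrE.
    by apply: sumr_ge0 => s _; exact: expR_ge0.
  by rewrite mulr_ge0 // expR_ge0.
rewrite exprMn -expRM_natl -[leLHS]mulrA -expRB le_eqVlt; apply/orP; left; apply/eqP.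
congr (_ * expR _); rewrite /l; field; exact: lt0r_neq0.
Qed.

End Hoeffding.

Local Open Scope classical_set_scope.

(** * Independent uniform samples: probabilities as counts *)

Section UniformSample.
Variables (R : realType) (d : measure_display) (Omega : measurableType d).
Variables (P : probability Omega R) (S : finType) (D : {set S}) (k : nat).
Variable T : 'I_k -> Omega -> S.
Hypothesis T_unif : forall i, uniformly_distributed P D (T i).
Hypothesis T_indep : mutually_independent P T.

Let sample t : {ffun 'I_k -> S} := [ffun i => T i t].

Let sample_fiberE f :
  sample @^-1` [set f] = \bigcap_(i in [set i | i \in [set: 'I_k]%SET])
    (T i @^-1` [set f i]).
Proof.
apply/seteqP; split=> t /=; first by move=> <- i _ /=; rewrite ffunE.
by move=> H; apply/ffunP => i; rewrite ffunE; apply: H => /=; rewrite finset.in_setT.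
Qed.

Let measurable_fiber f : measurable (sample @^-1` [set f]).
Proof.
rewrite sample_fiberE; apply: fin_bigcap_measurable => [|i _].
  exact: finite_finset.
by have [mT _] := T_unif i.
Qed.

Let prob_fiber f : P (sample @^-1` [set f]) =
  ((f \in ffun_on (mem D))%:R / #|D|%:R ^+ k)%:E.
Proof.
rewrite sample_fiberE T_indep.
under eq_bigr => i _ do rewrite (T_unif i).2.
rewrite prodEFin; congr (_%:E).
rewrite (eq_bigl xpredT); last by move=> i; rewrite finset.in_setT.
have [/ffun_onP fD|/ffun_onP fD] := boolP (f \in ffun_on (mem D)).
  under eq_bigr => i _ do rewrite (fD i).
  by rewrite prodr_const card_ord mul1r exprVn.
have [i fi] : exists i, f i \notin D.
  by apply/existsP; rewrite -negb_forall; apply/negP => /forallP.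
by rewrite (bigD1 i) //= (negbTE fi) !mul0r.
Qed.

(** The event is a finite disjoint union of fibres of the sample vector, and each fibre over a tuple
    in [D] has probability [#|D|%:R ^- k], the others zero. *)
Lemma uniform_sample_prob (Q : pred {ffun 'I_k -> S}) :
  P [set t | Q [ffun i => T i t]] =
  (#|[set f | (f \in ffun_on (mem D)) && Q f]%SET|%:R / #|D|%:R ^+ k)%:E.
Proof.
have -> : [set t | Q [ffun i => T i t]] =
    \bigcup_(f in [set` enum Q]) (sample @^-1` [set f]).
  apply/seteqP; split=> t /=.
    by move=> Qt; exists (sample t) => //=; rewrite mem_enum.
  by case=> f /= + fE; rewrite mem_enum -fE.
rewrite measure_fin_bigcup //; last first.
  by apply/trivIsetP => f g _ _ fg; apply/seteqP; split=> t //= -[-> gE];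
    rewrite gE eqxx in fg.
rewrite -fsbig_seq ?enum_uniq // big_enum /=.
under eq_bigr => f _ do rewrite prob_fiber.
rewrite sumEFin -mulr_suml; congr ((_ / _)%:E).
rewrite -natr_sum -big_mkcondr -sum1_card; congr (_%:R); apply: eq_bigl => f.
by rewrite finset.in_set andbC.
Qed.

End UniformSample.

(** * Two-sided concentration for all vertices at once *)

Section UniformConcentration.
Variables (R : realType) (d : measure_display) (Omega : measurableType d).
Variables (P : probability Omega R) (S : finType) (D : {set S}) (k : nat).
Variable T : 'I_k -> Omega -> S.
Hypothesis T_unif : forall i, uniformly_distributed P D (T i).
Hypothesis T_indep : mutually_independent P T.
Variables (V : finType) (Y : V -> S -> R) (c eps : R).
Hypotheses (c_gt0 : 0 < c) (eps_ge0 : 0 <= eps) (D_gt0 : (0 < #|D|)%N).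
Hypothesis Y_mean0 : forall u, \sum_(s in D) Y u s = 0.
Hypothesis Y_bound : forall u s, s \in D -> `|Y u s| <= c.

Lemma uniform_hoeffding :
  ((1 - 2 * #|V|%:R * expR (- (k%:R * eps ^+ 2 / (2 * c ^+ 2))))%:E <=
   P [set t | forall u, (`|\sum_i Y u (T i t)| <= k%:R * eps)%R])%E.
Proof.
set p := expR _.
pose Q (f : {ffun 'I_k -> S}) := [forall u, `|\sum_i Y u (f i)| <= k%:R * eps].
have -> : [set t | forall u, (`|\sum_i Y u (T i t)| <= k%:R * eps)%R] =
    [set t | Q [ffun i => T i t]].
  have E u t : \sum_i Y u ([ffun i => T i t] i) = \sum_i Y u (T i t).
    by apply: eq_bigr => i _; rewrite ffunE.
  apply/seteqP; split=> t /= H; first by apply/forallP => u; rewrite E.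
  by move=> u; rewrite -E; apply: (forallP H).
rewrite (uniform_sample_prob T_unif T_indep) lee_fin.
have N0 : 0 < #|D|%:R ^+ k :> R by rewrite exprn_gt0 // ltr0n.
(* The signs [s = 1] and [s = -1] give the two tails, each covered by the one-sided count. *)
pose big u (s : R) : {set {ffun 'I_k -> S}} := [set f | (f \in ffun_on (mem D)) &&
  (k%:R * eps < \sum_i s * Y u (f i))]%SET.
have big_le u s : `|s| = 1 -> #|big u s|%:R <= #|D|%:R ^+ k * p.
  move=> s1; apply: (hoeffding_count (Y := fun x => s * Y u x)) => // [|x xD].
    by rewrite -mulr_sumr Y_mean0 mulr0.
  by rewrite normrM s1 mul1r Y_bound.
pose bad : {set {ffun 'I_k -> S}} := [set f | (f \in ffun_on (mem D)) && ~~ Q f]%SET.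
have bad_le : #|bad|%:R <= #|D|%:R ^+ k * (2 * #|V|%:R * p).
  apply: (@le_trans _ _ (\sum_u (#|big u 1%R| + #|big u (-1)%R|))%N%:R).
    rewrite ler_nat.
    apply: (@leq_trans #|(\bigcup_u (big u 1%R :|: big u (-1)%R))%SET|).
      apply/subset_leq_card/fintype.subsetP => f; rewrite !finset.in_set.
      case/andP=> fD; rewrite negb_forall => /existsP[u]; rewrite -ltNge => fu.
      apply/finset.bigcupP; exists u => //; rewrite !finset.in_set fD /=.
      rewrite -!mulr_sumr mul1r mulN1r.
      by move: fu; rewrite ltr_normr.
    apply: (big_ind2 (fun (A : {set {ffun 'I_k -> S}}) m => (#|A| <= m)%N)).
    - by rewrite cards0.
    - move=> A m A' m' Am A'm'; apply: leq_trans (leq_card_setU _ _) _.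
      exact: leq_add.
    - by move=> u _; exact: leq_card_setU.
  rewrite natr_sum.
  apply: (@le_trans _ _ (\sum_(u : V) (#|D|%:R ^+ k * (2 * p)))).
    apply: ler_sum => u _; rewrite natrD.
    have := big_le u 1 (normr1 _); have := big_le u (-1) (normrN1 _); lra.
  rewrite sumr_const -[X in X <= _]mulr_natl; lra.
have -> : #|[set f | (f \in ffun_on (mem D)) && Q f]%SET|%:R =
    #|D|%:R ^+ k - #|bad|%:R :> R.
  apply/eqP; rewrite eq_sym subr_eq -natrD -natrX; apply/eqP; congr (_%:R).
  have := card_ffun_on 'I_k (mem D); rewrite card_ord => <-.
  rewrite -[LHS](cardID Q) addnC [RHS]addnC; congr (_ + _)%N; apply: eq_card => f;
    by rewrite !inE // andbC.
rewrite ler_pdivlMr // mulrBl mul1r lerD2l lerN2 mulrC.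
exact: bad_le.
Qed.

End UniformConcentration.

(** * Accuracy of the estimator with the stated number of samples *)

Local Open Scope ring_scope.

Theorem theorem4p4 (R : realType) (V : finType) (e : rel V)
  (e_sym : symmetric e) (e_irr : irreflexive e) (e_conn : connected_graph e)
  (v : V) (B : {set {set V}}) (B_bfs : is_bfs_tree v e B)
  (eps pf : R) (eps_gt0 : 0 < eps) (pf_gt0 : 0 < pf) (pf_lt1 : pf < 1)
  (omega : nat)
  (omega_ge : 32 * (diameter e)%:R ^+ 2 * ln (2 * #|V|%:R / pf) / eps ^+ 2
              <= omega%:R)
  (d : measure_display) (Omega : measurableType d) (P : probability Omega R)
  (T : 'I_omega -> Omega -> {set {set V}})
  (T_unif : forall i, uniformly_distributed P (spanning_trees e) (T i))
  (T_indep : mutually_independent P T) :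
  ((1 - pf)%:E <=
   P [set t | forall u : V,
       (`| estimator R v B (fun i => T i t) u
          - moore_penrose (laplacian R e) (enum_rank u) (enum_rank u) |
       <= eps)%R])%E.
Proof.
have [B_tree B_size] := B_bfs.
have tB : B \in spanning_trees e by rewrite finset.in_set; exact/asboolP.
have N0 : (0 < #|spanning_trees e|)%N by apply/card_gt0P; exists B.
(* Hoeffding's bound is applied with [c = 4 * D > 0]. For diameter zero all BFS paths are empty, and
   both the estimate and the diagonal entry are zero. *)
have [D0|D_gt0] := posnP (diameter e).
  rewrite [X in P X](_ : _ = setT) ?probability_setT ?lee_fin ?lerBlDr ?lerDl ?ltW //.
  apply/seteqP; split=> // t _ u /=.
  have x0 x : root_path_edges v B x = [::].
    apply/eqP; rewrite -size_eq0 size2_zip ?leqnSn // B_size -leqn0 -D0.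
    exact: gdist_le_diameter.
  have := pinv_diag_bound R e_sym e_irr e_conn N0 u; rewrite D0 normr_le0 => /eqP.
  rewrite /Lpinv => ->; rewrite subr0 /estimator big1 ?mulr0 ?normr0 ?ltW // => i _.
  rewrite big1 => [|w _]; last by rewrite /x2 x0 big_nil.
  by rewrite /x1 /x2 x0 !big_nil !mulr0 subr0 addr0.
set D := diameter e in D_gt0 omega_ge *.
have DR : 0 < D%:R :> R by rewrite ltr0n.
have n1 : 1 <= #|V|%:R :> R by rewrite ler1n; apply/card_gt0P; exists v.
have q1 : 1 < 2 * #|V|%:R / pf by rewrite ltr_pdivlMr // mul1r; lra.
have omega_gt0 : 0 < omega%:R :> R.
  apply: lt_le_trans omega_ge.
  by rewrite divr_gt0 ?exprn_gt0 // mulr_gt0 ?ln_gt0 // mulr_gt0 // exprn_gt0.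
have c_gt0 : 0 < 4 * D%:R :> R by rewrite mulr_gt0.
pose Y u T := tree_sample R v B T u - Lpinv R e u u.
have Y_bound u F : F \in spanning_trees e -> `|Y u F| <= 4 * D%:R.
  move=> tF; have H1 := tree_sample_bound R u B_bfs tF.
  have H2 := pinv_diag_bound R e_sym e_irr e_conn N0 u.
  by apply: le_trans (ler_normB _ _) _; move: H1 H2; rewrite -/D; lra.
have Y_mean0 u : \sum_(F in spanning_trees e) Y u F = 0.
  exact: sum_tree_sample.
have := uniform_hoeffding T_unif T_indep c_gt0 (ltW eps_gt0) N0 Y_mean0 Y_bound.
have -> : [set t | forall u, `|\sum_(i < omega) Y u (T i t)| <= omega%:R * eps] =
  [set t | forall u : V,
       (`| estimator R v B (fun i => T i t) u
          - moore_penrose (laplacian R e) (enum_rank u) (enum_rank u) |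
       <= eps)%R].
  apply/funext => t; apply/propext.
  suff E u : `| estimator R v B (fun i => T i t) u
          - moore_penrose (laplacian R e) (enum_rank u) (enum_rank u) | =
      omega%:R^-1 * `|\sum_(i < omega) Y u (T i t)|.
    by split=> H u; move: (H u); rewrite E ler_pdivrMl.
  rewrite -[omega%:R^-1]gtr0_norm ?invr_gt0 // -normrM sumrB mulrBr.
  congr (`|_ - _|); rewrite sumr_const card_ord -[X in _ * X]mulr_natl mulKf //.
  exact: lt0r_neq0.
apply: le_trans; rewrite lee_fin lerD2l lerN2.
(* With [c = 4 * D] the denominator [2 * c ^+ 2] is [32 * D ^+ 2], so the hypothesis on [omega] says
   that [x] is at least the logarithm, and the failure probability is at most [pf]. *)
set x := omega%:R * _ / _.
have xq : ln (2 * #|V|%:R / pf) <= x.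
  rewrite /x ler_pdivlMr; last by rewrite mulr_gt0 // exprn_gt0.
  move: omega_ge; rewrite ler_pdivrMr ?exprn_gt0 //; apply: le_trans.
  by rewrite le_eqVlt; apply/orP; left; apply/eqP; ring.
rewrite mulrC -ler_pdivlMr; last by lra.
rewrite (_ : pf / _ = expR (- ln (2 * #|V|%:R / pf))); first by rewrite ler_expR lerN2.
by rewrite expRN lnK ?invf_div // posrE; lra.
Qed.
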